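(* Let $X$ be a real Banach space and let $Y$ be a finite dimensional subspace of $X$ such that there exists a norm one continuous linear projection $P:X\to Y$. If the (quotient) norm of $X/Y$ is non rough, then the norm of $X$ is non rough.
   Context: All Banach spaces are real. $B_{Z}$ denotes the closed unit ball of $Z$. For a Banach space $Z$, a $w^*$-slice of $B_{Z^*}$ is a set $\{z^*\in B_{Z^*}: z^*(z)>\sup_{y^*\in B_{Z^*}}y^*(z)-\alpha\}$ with $z\in Z$, $\alpha>0$. For $\varepsilon>0$, the norm of $Z$ is $\varepsilon$-rough if every $w^*$-slice of $B_{Z^*}$ has diameter $\geq\varepsilon$; it is non rough if it is not $\varepsilon$-rough for any $\varepsilon>0$. A projection $P:X\to Y$ onto a subspace $Y$ is a linear map with $P(X)=Y$ and $Py=y$ for all $y\in Y$. *)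

(* Defs.v *)
From HB Require Import structures.
From mathcomp Require Import all_boot all_order all_algebra ring_quotient.
From mathcomp Require Import all_classical all_reals all_analysis.

Set Implicit Arguments.
Unset Strict Implicit.
Unset Printing Implicit Defensive.

Import Order.TTheory GRing.Theory Num.Theory.
Import numFieldNormedType.Exports.

Local Open Scope classical_set_scope.
Local Open Scope ring_scope.
Local Open Scope quotient_scope.

Definition opnorm (R : realType) (V W : normedModType R) (f : V -> W) : \bar R :=
  ereal_sup [set `|f x|%:E | x in [set x : V | `|x| <= 1]].

(* The dual Z^* is the set of continuous elements of [{linear Z -> R^o}]. *)
Definition dual_ball (R : realType) (Z : normedModType R) :
    set {linear Z -> R^o} :=
  [set f : {linear Z -> R^o} |
     continuous f /\ (opnorm (f : Z -> R^o) <= 1%:E)%E].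
Arguments dual_ball {R} Z.

Definition wstar_slice (R : realType) (Z : normedModType R) (z : Z) (alpha : R) :
    set {linear Z -> R^o} :=
  [set f : {linear Z -> R^o} | dual_ball Z f /\
     sup [set (g z : R) | g in dual_ball Z] - alpha < (f z : R)].

Definition dual_diam (R : realType) (Z : normedModType R)
    (A : set {linear Z -> R^o}) : \bar R :=
  ereal_sup [set opnorm (fg.1 \- fg.2 : Z -> R^o) | fg in A `*` A].

Definition rough (R : realType) (Z : normedModType R) (eps : R) : Prop :=
  forall (z : Z) (alpha : R), 0 < alpha ->
    (eps%:E <= dual_diam (wstar_slice z alpha))%E.
Arguments rough {R} Z eps.

Definition non_rough (R : realType) (Z : normedModType R) : Prop :=
  forall eps : R, 0 < eps -> ~ rough Z eps.
Arguments non_rough {R} Z.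

Definition finite_dimensional (R : realType) (V : lmodType R)
    (Y : submodClosed V) : Prop :=
  exists (n : nat) (e : 'I_n -> V), forall y : V,
    y \in Y <-> exists a : 'I_n -> R, y = \sum_(i < n) a i *: e i.

Section finite_dimensional_closed.
Variables (R : realType) (V : normedModType R).

Lemma closed_add_line (L : set V) (v : V) :
  L 0 -> (forall (a : R) x y, L x -> L y -> L (a *: x + y)) ->
  closed L -> closed [set x | exists a : R, L (x - a *: v)].
Proof.
move=> L0 Llin cL.
have LB x y : L x -> L y -> L (x - y).
  by move=> Lx Ly; rewrite addrC -scaleN1r; apply: Llin.
have [vL|vL] := pselect (L v).
  have -> // : [set x | exists a : R, L (x - a *: v)] = L.
  apply/seteqP; split=> x /= => [[a xaL]|xL]; last first.
    by exists 0; rewrite scale0r subr0.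
  by rewrite -(subrK (a *: v) x) addrC; apply: Llin.
have [d d0 dL] : exists2 d : R, 0 < d & forall l, L l -> d <= `|v - l|.
  have : nbhs v (~` L).
    by apply: open_nbhs_nbhs; split => //; exact: closed_openC.
  move=> /nbhs_ballP[d /= d0 dL]; exists d => // l lL; rewrite leNgt.
  by apply/negP => vl; apply: (dL l); rewrite // -ball_normE.
have dle (a : R) (l : V) : L l -> d * `|a| <= `|l + a *: v|.
  move=> lL; have [->|a0] := eqVneq a 0; first by rewrite normr0 mulr0.
  have -> : l + a *: v = a *: (v - (- a^-1 *: l)).
    by rewrite scalerBr scalerA mulrN divff// scaleN1r opprK addrC.
  rewrite normrZ mulrC ler_wpM2l// dL//.
  by rewrite -[_ *: l]addr0; apply: Llin.
set S := [set x | _] => x xS.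
have cS (y : V) : {a : R | S y -> L (y - a *: v)}.
  apply: cid; have [[a ya]|nS] := pselect (S y); first by exists a.
  by exists 0.
pose c y := projT1 (cS y).
have cP y : S y -> L (y - c y *: v) by rewrite /c; case: (cS y).
have cle s t : S s -> S t -> d * `|c s - c t| <= `|s - t|.
  move=> Ss St; have := dle (c s - c t) _ (LB _ _ (cP _ Ss) (cP _ St)).
  by rewrite scalerBl opprB addrAC !addrA !subrK.
pose F := within S (nbhs x).
have PF : ProperFilter F by exact: within_nbhs_proper.
have cvgc : cvg (c @ F).
  apply: cauchy_cvg; apply/cauchyP => e e0.
  have de0 : 0 < d * e / 2 by rewrite divr_gt0// mulr_gt0.
  have [s [Ss xs]] := xS _ (nbhsx_ballx x _ de0).
  exists (c s); rewrite /F /fmap/=.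
  apply: filterS (nbhsx_ballx x _ de0) => t xt St.
  rewrite -ball_normE /= -(ltr_pM2l d0).
  apply: le_lt_trans (cle _ _ Ss St) _.
  rewrite -ball_normE /= in xs xt.
  by rewrite (le_lt_trans (ler_distD x s t))// [ltRHS]splitr ltrD// distrC.
move/cvg_ex : cvgc => [a ca]; exists a.
have cvgL : (fun s => s - c s *: v) @ F --> x - a *: v.
  apply: cvgB; first exact: cvg_within.
  by apply: cvgZr_tmp.
apply: (@closed_cvg _ _ F _ (fun s => s - c s *: v) L cL _ _ cvgL).
by rewrite /F near_withinE; apply: nearW => s; exact: cP.
Qed.

Lemma finite_dimensional_closed (Y : submodClosed V) :
  finite_dimensional Y -> closed [set` Y].
Proof.
move=> [n [e Ye]].
have -> : [set` Y] = [set y | exists a : 'I_n -> R, y = \sum_(i < n) a i *: e i].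
  by apply/seteqP; split=> y /= /Ye.
elim: n e {Y Ye} => [|n IHn] e.
  have -> : [set y : V | exists a : 'I_0 -> R, y = \sum_(i < 0) a i *: e i] =
      [set 0].
    apply/seteqP; split=> y /= => [[a ->]|->]; first by rewrite big_ord0.
    by exists (fun=> 0); rewrite big_ord0.
  exact/accessible_closed_set1/hausdorff_accessible/norm_hausdorff.
pose e' := e \o widen_ord (leqnSn n).
suff -> : [set y | exists a : 'I_n.+1 -> R, y = \sum_(i < n.+1) a i *: e i] =
    [set x | exists a : R, [set y | exists b : 'I_n -> R,
      y = \sum_(i < n) b i *: e' i] (x - a *: e ord_max)].
  apply: closed_add_line => /=; last exact: IHn.
    by exists (fun=> 0); rewrite big1// => i _; rewrite scale0r.
  move=> a _ _ [b ->] [b' ->]; exists (fun i => a * b i + b' i).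
  rewrite scaler_sumr -big_split/=; apply: eq_bigr => i _.
  by rewrite scalerDl scalerA.
apply/seteqP; split=> x /=.
  move=> [a ->]; exists (a ord_max), (a \o widen_ord (leqnSn n)).
  by rewrite big_ord_recr/= addrK.
move=> [a [b /eqP]]; rewrite subr_eq => /eqP ->.
exists (fun i => if unlift ord_max i is Some j then b j else a).
rewrite big_ord_recr/= unlift_none; congr (_ + _).
apply: eq_bigr => i _.
have -> : widen_ord (leqnSn n) i = lift ord_max i.
  by apply: val_inj; rewrite /= /bump leqNgt ltn_ord.
rewrite liftK /e'/=; congr (_ *: e _).
by apply: val_inj; rewrite /= /bump leqNgt ltn_ord.
Qed.

End finite_dimensional_closed.

Section quotient_lmodule.
Variables (R : pzRingType) (V : lmodType R) (Y : submodClosed V).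

(* [submodClosed] does not inherit from [zmodClosed], which [{ideal_quot _}] needs,
   although over a ring it implies it. *)
Definition zmod_of_submod : {pred V} := Y.

Let zmod_of_submod_closed : submod_closed zmod_of_submod.
Proof.
split=> [|a x y xY yY]; first exact: (rpred0 Y).
by apply: (@rpredD V Y) => //; exact: rpredZ.
Qed.

HB.instance Definition _ :=
  GRing.isSubmodClosed.Build R V zmod_of_submod zmod_of_submod_closed.

Definition quotient_lmod : Type := {ideal_quot zmod_of_submod}.
Local Notation Q := quotient_lmod.
HB.instance Definition _ := GRing.Zmodule.on Q.

Definition quotient_map (x : V) : Q := \pi_({ideal_quot zmod_of_submod}) x.

Let quotient_map_zmod : zmod_morphism quotient_map.
Proof. by move=> x y; rewrite /quotient_map raddfB. Qed.
HB.instance Definition _ :=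
  GRing.isZmodMorphism.Build V Q quotient_map quotient_map_zmod.

Lemma quotient_map_eq (x y : V) :
  quotient_map x = quotient_map y <-> x - y \in Y.
Proof.
rewrite -[x - y \in Y]/(x - y \in zmod_of_submod) Quotient.idealrBE.
by split=> [xy|/eqP//]; apply/eqP.
Qed.

Lemma quotient_map_surj (q : Q) : exists x, quotient_map x = q.
Proof. by exists (repr (q : {ideal_quot zmod_of_submod})); exact: reprK. Qed.

Let scaleq (a : R) (q : Q) : Q :=
  quotient_map (a *: repr (q : {ideal_quot zmod_of_submod})).

Let scaleqE a x : scaleq a (quotient_map x) = quotient_map (a *: x).
Proof.
apply/quotient_map_eq; rewrite -scalerBr rpredZ//.
by apply/quotient_map_eq; exact: reprK.
Qed.

Let scaleqA a b q : scaleq a (scaleq b q) = scaleq (a * b) q.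
Proof. by have [x <-] := quotient_map_surj q; rewrite !scaleqE scalerA. Qed.

Let scale1q : left_id 1 scaleq.
Proof. by move=> q; have [x <-] := quotient_map_surj q; rewrite scaleqE scale1r. Qed.

Let scaleqDr : right_distributive scaleq +%R.
Proof.
move=> a p q; have [[x <-] [y <-]] := (quotient_map_surj p, quotient_map_surj q).
by rewrite -raddfD !scaleqE scalerDr raddfD.
Qed.

Let scaleqDl q : {morph scaleq^~ q : a b / a + b}.
Proof.
move=> a b; have [x <-] := quotient_map_surj q.
by rewrite !scaleqE scalerDl raddfD.
Qed.

HB.instance Definition _ := GRing.Zmodule_isLmodule.Build R Q
  scaleqA scale1q scaleqDr scaleqDl.

Let quotient_map_scalable : scalable quotient_map.
Proof. by move=> a x; rewrite -scaleqE. Qed.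
HB.instance Definition _ :=
  GRing.isScalable.Build R V Q *:%R quotient_map quotient_map_scalable.

End quotient_lmodule.

(* The quotient seminorm is a norm only when [Y] is closed: the alias
   [quotient_space] carries the closedness proof. *)
Definition quotient_space (R : realType) (V : normedModType R)
  (Y : submodClosed V) (cY : closed [set` Y]) : Type := quotient_lmod Y.

Section quotient_norm.
Variables (R : realType) (V : normedModType R) (Y : submodClosed V).
Variable cY : closed [set` Y].
Local Notation Q := (quotient_space cY).
Local Notation pi := (quotient_map Y).

HB.instance Definition _ := GRing.Lmodule.on Q.

Definition quotient_norm (q : Q) : R := inf [set `|x| | x in pi @^-1` [set q]].

Lemma quotient_norm_le x : quotient_norm (pi x) <= `|x|.
Proof.
by apply: ge_inf; [exists 0 => _ [y _ <-]; exact: normr_ge0|exists x].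
Qed.

Lemma quotient_norm_adh (q : Q) (e : R) : 0 < e ->
  exists2 x, pi x = q & `|x| < quotient_norm q + e.
Proof.
move=> e0; have [|_ [x qx <-] xe] :=
    @inf_adherent _ [set `|x| | x in pi @^-1` [set q]] e e0.
  split; last by exists 0 => _ [y _ <-]; exact: normr_ge0.
  by have [x xq] := quotient_map_surj q; exists `|x|, x.
by exists x.
Qed.

Let quotient_normD (p q : Q) :
  quotient_norm (p + q) <= quotient_norm p + quotient_norm q.
Proof.
apply/ler_addgt0Pr => e e0.
have e20 : 0 < e / 2 by rewrite divr_gt0.
have [x xp xe] := quotient_norm_adh p e20.
have [y yq ye] := quotient_norm_adh q e20.
rewrite -xp -yq -raddfD (le_trans (quotient_norm_le _))//.
rewrite (le_trans (ler_normD _ _))// xp yq [e]splitr addrACA.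
by rewrite lerD// ltW.
Qed.

Let quotient_norm0 : quotient_norm (0 : Q) = 0.
Proof.
apply/eqP; rewrite eq_le; apply/andP; split.
  by rewrite -(raddf0 pi) (le_trans (quotient_norm_le _))// normr0.
by apply: lb_le_inf => [|_ [y _ <-]//]; exists `|0 : V|, 0 => //=; rewrite raddf0.
Qed.

Let quotient_normZ_le (a : R) (q : Q) :
  a != 0 -> quotient_norm (a *: q) <= `|a| * quotient_norm q.
Proof.
move=> a0; rewrite -ler_pdivrMl ?normr_gt0//; apply/ler_addgt0Pr => e e0.
have [x <- xe] := quotient_norm_adh q e0.
rewrite ler_pdivrMl ?normr_gt0// -linearZ (le_trans (quotient_norm_le _))//.
by rewrite normrZ ler_wpM2l// ltW// -{1}xe.
Qed.

Let quotient_normZ (a : R) (q : Q) :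
  quotient_norm (a *: q) = `|a| * quotient_norm q.
Proof.
have [->|a0] := eqVneq a 0; first by rewrite scale0r quotient_norm0 normr0 mul0r.
apply/eqP; rewrite eq_le quotient_normZ_le//=.
rewrite -ler_pdivlMl ?normr_gt0// -normfV.
rewrite -{1}[q](scalerK a0); apply: quotient_normZ_le.
by rewrite invr_eq0.
Qed.

Let quotient_norm_eq0 (q : Q) : quotient_norm q = 0 -> q = 0.
Proof.
have [x <-] := quotient_map_surj q => qx0.
suff : [set` Y] x.
  by move=> xY; rewrite -(raddf0 pi); apply/quotient_map_eq; rewrite subr0.
apply: cY => B /nbhs_ballP[e /= e0 xB].
have [y yx ye] := quotient_norm_adh (pi x) e0.
exists (x - y); split; first by apply/quotient_map_eq.
apply: xB; rewrite -ball_normE/= opprB addrC subrK.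
by rewrite qx0 add0r in ye.
Qed.

HB.instance Definition _ := Lmodule_isNormed.Build R Q
  quotient_normD quotient_normZ quotient_norm_eq0.

Lemma quotient_normE (q : Q) :
  `|q| = inf [set `|x| | x in [set x : V | pi x = q]].
Proof. by []. Qed.

End quotient_norm.

(* Main.v *)
Require Import Defs.
From HB Require Import structures.
From mathcomp Require Import all_boot all_order all_algebra ring_quotient.
From mathcomp Require Import all_classical all_reals all_analysis.
From mathcomp Require Import ring lra.

(** The dual ball of [X/Y] is the section of the dual ball of [X] by the
    annihilator of [Y], so it is enough to show that small slices pass from the
    section [C'] of [C] by a hyperplane [f e = 0] to [C] itself, where [C] is the
    section of the dual ball by the annihilator of a set; [Y] being finite
    dimensional, finitely many such steps suffice.  Translating [x] along [e],
    the supremum [h] of [x] over [C] and [C'] may be taken to be the same.  Let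
    [b] (resp. [-a]) be the largest (resp. smallest) limit of [f e] over [f] in
    [C] with [f x] tending to [h]; up to the sign of [e], [b <= a].  For small [t],
    a slice of [C] for [x + t e] consists of [f] with [f x] close to [h] and [f e]
    close to [b]; with a fixed [g] near the other end, the average of [f] and
    [(b / a) g] nearly lies in the small slice of [C'], with a weight at least
    [1/2] on [f].  Hence two such [f] are close to each other. *)

Set Implicit Arguments.
Unset Strict Implicit.
Unset Printing Implicit Defensive.

Import Order.TTheory GRing.Theory Num.Theory.
Import numFieldNormedType.Exports.

Local Open Scope classical_set_scope.
Local Open Scope ring_scope.

(** * Functionals in the dual ball and its sections by annihilators *)

Section dual_ball.
Variables (R : realType) (Z : normedModType R).
Implicit Types (f g u : {linear Z -> R^o}) (z : Z) (A : set Z).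

Lemma opnorm_leP (h : {linear Z -> R^o}) (c : R) : 0 <= c ->
  (opnorm (h : Z -> R^o) <= c%:E)%E <-> forall z, `|h z : R| <= c * `|z|.
Proof.
move=> c0; split=> [hc z|hc].
  have [->|z0] := eqVneq z 0; first by rewrite linear0 !normr0 mulr0.
  have nz0 : 0 < `|z| by rewrite normr_gt0.
  have z'1 : `| `|z|^-1 *: z| <= 1.
    by rewrite normrZ normfV normr_id mulVf// gt_eqF.
  have : (`|h (`|z|^-1 *: z)|%:E <= c%:E)%E.
    by apply: le_trans hc; apply: ereal_sup_ubound; exists (`|z|^-1 *: z).
  by rewrite lee_fin linearZ /= normrM normfV normr_id mulrC ler_pdivrMr.
rewrite /opnorm; apply: ge_ereal_sup => _ [z /= z1 <-].
by rewrite lee_fin (le_trans (hc z))// ler_piMr.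
Qed.

Lemma dual_ballP f : dual_ball Z f <-> forall z, `|f z : R| <= `|z|.
Proof.
split=> [[_ /(opnorm_leP _ ler01) f1] z|f1]; first by rewrite -[leRHS]mul1r.
split; last by apply/(opnorm_leP _ ler01) => z; rewrite mul1r.
apply/linear_bounded_continuous/linear_boundedP; exists 1; split=> // r r1 z.
by rewrite (le_trans (f1 z))// ler_peMl// ltW.
Qed.

(** For [A] empty this is the whole dual ball; for [A] a closed subspace it is a copy of the dual
    ball of the quotient. *)
Definition annihilator_ball A : set {linear Z -> R^o} :=
  [set f | dual_ball Z f /\ forall x, A x -> f x = 0].

Lemma annihilator_ball_le A f z : annihilator_ball A f -> `|f z : R| <= `|z|.
Proof. by move=> [/dual_ballP]. Qed.

(** Absolute convexity with three terms: two to be averaged and one correcting the value at a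
    vector. *)
Lemma annihilator_ball_comb A f g u (a b c : R) :
  annihilator_ball A f -> annihilator_ball A g -> annihilator_ball A u ->
  `|a| + `|b| + `|c| <= 1 ->
  exists2 k, annihilator_ball A k &
    forall z, (k z : R) = a * (f z : R) + b * (g z : R) + c * (u z : R).
Proof.
move=> Af Ag Au abc.
exists (a \*: f \+ b \*: g \+ c \*: u : {linear Z -> R^o}) => //; split=> [|x Ax].
  apply/dual_ballP => z /=.
  apply: le_trans (_ : _ <= (`|a| + `|b| + `|c|) * `|z|) _; last exact: ler_piMl.
  rewrite 2!mulrDl; apply: (le_trans (ler_normD _ _)); apply: lerD.
    apply: (le_trans (ler_normD _ _)); apply: lerD; rewrite normrM.
      by apply: ler_wpM2l => //; exact: annihilator_ball_le Af.
    by apply: ler_wpM2l => //; exact: annihilator_ball_le Ag.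
  by rewrite normrM; apply: ler_wpM2l => //; exact: annihilator_ball_le Au.
by rewrite /= (Af.2 x)// (Ag.2 x)// (Au.2 x)// !scaler0 !addr0.
Qed.

Lemma annihilator_ball0 A : annihilator_ball A (\0 : {linear Z -> R^o}).
Proof. by split=> //; apply/dual_ballP => z; rewrite normr0. Qed.

Lemma annihilator_ballN A f :
  annihilator_ball A f -> exists2 g, annihilator_ball A g & forall z, g z = - f z.
Proof.
move=> Af; have [|k Ak kE] := @annihilator_ball_comb A f f f (-1) 0 0 Af Af Af.
  by rewrite normrN1 normr0 !addr0.
by exists k => // z; rewrite kE !mul0r !addr0 mulN1r.
Qed.

Lemma annihilator_ballU A e f :
  annihilator_ball (A `|` [set e]) f <-> annihilator_ball A f /\ f e = 0.
Proof.
split=> [[f1 fA]|[[f1 fA] fe]].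
  by split; [split=> // x Ax; apply: fA; left|apply: fA; right].
by split=> // x [/fA//|->].
Qed.

(** * Small slices and one-sided slopes of the support function *)

Lemma linear_shift f (x e : Z) (t : R) :
  (f (x + t *: e) : R) = (f x : R) + t * (f e : R).
Proof. by rewrite linearD linearZ. Qed.

(** A slice is given by its level [m], so nonemptiness is required separately; the diameter bound is
    pointwise, which avoids extended reals. *)
Definition small_slice A (eps : R) := exists (x : Z) (m : R),
  (exists2 f, annihilator_ball A f & m < f x :> R) /\
  forall f g, annihilator_ball A f -> annihilator_ball A g ->
    m < f x :> R -> m < g x :> R ->
    forall z, `|(f z : R) - (g z : R)| <= eps * `|z|.

(* [b] is the right derivative at [t = 0] of the support function
   [t |-> sup {f (x + t *: e) | f in annihilator_ball A}], when [h] is its value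
   at [0]. *)
Definition top_slope A (x e : Z) (h b : R) :=
  (forall eta, 0 < eta -> exists2 d : R, 0 < d &
    forall f, annihilator_ball A f -> h - d < f x :> R -> (f e : R) < b + eta) /\
  (forall eta d, 0 < eta -> 0 < d ->
    exists f, [/\ annihilator_ball A f, h - d < f x :> R & b - eta < f e :> R]).

Lemma top_slope_exists A (x e : Z) (h : R) :
  (forall d, 0 < d -> exists f, [/\ annihilator_ball A f, f e = 0 & h - d < f x :> R]) ->
  exists2 b, 0 <= b & top_slope A x e h b.
Proof.
move=> h_adh.
(* [T] collects the values that [f e] still reaches with [f x] arbitrarily close to [h]; the
   hypothesis puts 0 in it, whence [0 <= b]. *)
pose T := [set t : R | forall d, 0 < d ->
  exists f, [/\ annihilator_ball A f, h - d < f x :> R & t <= f e :> R]].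
have T0 : T 0.
  by move=> d /h_adh[f [Af fe fx]]; exists f; split; rewrite ?fe.
have ubT : has_ubound T.
  exists `|e| => t /(_ 1 ltr01)[f [Af _ /le_trans]]; apply.
  by rewrite (le_trans (ler_norm _))// (annihilator_ball_le _ Af).
have supT : has_sup T by split; [exists 0|].
exists (sup T); first exact: ub_le_sup.
split=> [eta eta0|eta d eta0 d0].
  have [d [d0 dT]] : exists d, 0 < d /\ forall f, annihilator_ball A f ->
      h - d < f x :> R -> ~ (sup T + eta <= f e :> R).
    apply: contrapT => nd.
    suff : T (sup T + eta) by move=> /(ub_le_sup ubT); lra.
    move=> d d0; apply: contrapT => nf; apply: nd; exists d; split=> // f Af fx fe.
    by apply: nf; exists f.
  by exists d => // f Af fx; rewrite ltNge; apply/negP; exact: dT.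
have [t Tt tT] := sup_adherent eta0 supT.
by have [f [Af fx fe]] := Tt _ d0; exists f; split=> //; exact: lt_le_trans fe.
Qed.

(* [F] is the average of [f] and [mu g] corrected by [c u] to vanish at [e]. *)
Lemma annihilator_ball_kernel A (x e : Z) (h m0 a b mu kappa delta : R) f g u :
  (forall k, annihilator_ball A k -> (k x : R) <= h) ->
  annihilator_ball A f -> annihilator_ball A g -> annihilator_ball A u ->
  0 < u e :> R -> 0 <= mu -> mu <= 1 -> mu * a = b ->
  h - delta < f x :> R -> h - delta < g x :> R ->
  `|(f e : R) - b| <= kappa * u e / 2 -> `|(g e : R) + a| <= kappa * u e / 2 ->
  delta <= (h - m0) / 2 -> kappa * (`|x| + `|m0|) < (h - m0) / 2 ->
  exists F c, [/\ annihilator_ball A F, F e = 0, m0 < F x :> R, `|c| <= kappa &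
    forall z, (1 + mu + `|c|) * (F z : R) = (f z : R) + mu * (g z : R) + c * (u z : R)].
Proof.
move=> xh Af Ag Au ue mu0 mu1 muab fx gx fe ge dh kh.
have [c cu ck] : exists2 c, c * (u e : R) = - ((f e : R) + mu * (g e : R)) &
    `|c| <= kappa.
  exists (- ((f e : R) + mu * (g e : R)) / (u e : R)); first by rewrite divfK// gt_eqF.
  rewrite normrM normfV normrN (gtr0_norm ue) ler_pdivrMr//.
  have -> : (f e : R) + mu * (g e : R) = ((f e : R) - b) + mu * ((g e : R) + a).
    by rewrite -muab; ring.
  rewrite (le_trans (ler_normD _ _))// normrM (ger0_norm mu0).
  have : mu * `|(g e : R) + a| <= 1 * `|(g e : R) + a| by rewrite ler_wpM2r.
  by lra.
(* [W] is the sum of the absolute values of the weights, so dividing by it keeps [F] in the ball. *)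
pose W := 1 + mu + `|c|.
have W0 : 0 < W by rewrite /W ltr_wpDr// ltr_wpDr.
have Wn : W != 0 by rewrite gt_eqF.
have [|F AF FE] := @annihilator_ball_comb _ f g u W^-1 (mu / W) (c / W) Af Ag Au.
  rewrite !normrM !normfV (gtr0_norm W0) (ger0_norm mu0) -{1}[W^-1]mul1r -!mulrDl.
  by rewrite -/W divff.
have WF z : W * (F z : R) = (f z : R) + mu * (g z : R) + c * (u z : R).
  by rewrite FE; field.
exists F, c; split=> //.
- apply: (mulfI Wn); by rewrite WF mulr0 cu addrN.
- rewrite -(ltr_pM2l W0) WF.
  have cx : - (`|c| * (`|x| + `|m0|)) <= c * (u x : R) - `|c| * m0.
    have h1 : `|c * (u x : R)| <= `|c| * `|x|.
      by rewrite normrM ler_wpM2l// (annihilator_ball_le _ Au).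
    have h2 : `|c| * m0 <= `|c| * `|m0| by rewrite ler_wpM2l// ler_norm.
    by have := ler_norm (- (c * (u x : R))); rewrite normrN; lra.
  have cN : `|c| * (`|x| + `|m0|) <= kappa * (`|x| + `|m0|).
    by rewrite ler_wpM2r// addr_ge0.
  (* With [fx] this gives [0 < delta], hence [m0 < h], from which [gm] follows. *)
  have fh := xh _ Af.
  have gm : 0 <= mu * ((g x : R) - m0) by rewrite mulr_ge0//; lra.
  by rewrite /W; lra.
Qed.

(** The factor 5 covers [3 * eps] from the averages, whose total weight is at most 3, and
    [3 * kappa <= 3 / 2 * eps] from the corrections. *)
Lemma small_slice_top_slope A (x e : Z) (h m0 a b eps : R) u :
  0 < eps -> m0 < h ->
  (forall k, annihilator_ball A k -> (k x : R) <= h) ->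
  annihilator_ball A u -> 0 < u e :> R -> 0 <= b <= a ->
  top_slope A x e h b -> top_slope A x (- e) h a ->
  (forall f g, annihilator_ball A f -> annihilator_ball A g ->
    f e = 0 -> g e = 0 -> m0 < f x :> R -> m0 < g x :> R ->
    forall z, `|(f z : R) - (g z : R)| <= eps * `|z|) ->
  small_slice A (5 * eps).
Proof.
move=> eps0 mh xh Au ue /andP[b0 ba] [tb1 tb2] [ta1 ta2] small.
pose N := `|x| + `|m0| + 1.
have N0 : 0 < N by rewrite /N ltr_wpDl// addr_ge0.
(* The three bounds serve, in order, the total weight, the error of the corrections, and [kN]. *)
pose kappa := Num.min 1 (Num.min (eps / 2) ((h - m0) / (2 * N))).
have k0 : 0 < kappa.
  by rewrite !lt_min ltr01 !divr_gt0 ?subr_gt0// mulr_gt0.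
have k1 : kappa <= 1 by rewrite ge_min lexx.
have ke : kappa <= eps / 2 by rewrite !ge_min lexx ?orbT.
have kN : kappa * (`|x| + `|m0|) < (h - m0) / 2.
  have : kappa * N <= (h - m0) / 2.
    apply: le_trans (_ : (h - m0) / (2 * N) * N <= _).
      by rewrite ler_pM2r// !ge_min lexx ?orbT.
    by rewrite invfM mulrA divfK// gt_eqF.
  by rewrite /N; lra.
pose eta := kappa * (u e : R) / 2.
have eta0 : 0 < eta by rewrite divr_gt0// mulr_gt0.
have [d1 d10 d1b] := tb1 _ eta0.
have [d2 d20 d2a] := ta1 _ eta0.
pose d := Num.min ((h - m0) / 2) (Num.min d1 d2).
have d0 : 0 < d by rewrite !lt_min d10 d20 divr_gt0 ?subr_gt0.
have dh : d <= (h - m0) / 2 by rewrite ge_min lexx.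
have dd1 : d <= d1 by rewrite !ge_min lexx ?orbT.
have dd2 : d <= d2 by rewrite !ge_min lexx ?orbT.
have [g [Ag gx ge]] := ta2 _ _ eta0 d0.
have ge' : `|(g e : R) + a| <= eta.
  have := d2a g Ag; rewrite linearN /= in ge *; rewrite ler_norml => /(_ _); lra.
pose t := d / (eta + `|e|).
have eK : 0 < eta + `|e| by rewrite ltr_wpDr.
have t0 : 0 < t by rewrite divr_gt0.
have tK : t * (eta + `|e|) = d by rewrite /t divfK// gt_eqF.
(* If [a = 0] then [b = 0], and the convention [b / 0 = 0] still gives [mu * a = b]. *)
pose mu := b / a.
have mua : mu * a = b.
  rewrite /mu; have [a0|a0] := eqVneq a 0; last by rewrite divfK.
  by rewrite a0 mulr0; apply/eqP; rewrite eq_le b0 -a0 ba.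
have mu0 : 0 <= mu by rewrite divr_ge0// (le_trans b0).
have mu1 : mu <= 1.
  rewrite /mu; have [a0|a0] := eqVneq a 0; first by rewrite a0 invr0 mulr0.
  by rewrite ler_pdivrMr ?mul1r// lt0r a0 (le_trans b0).
(* From [f x <= h] comes [b - eta < f e]; from [f e <= |e|] and the choice of [t] comes
   [h - d < f x], and then [d <= d1] bounds [f e] above. *)
have tilt f : annihilator_ball A f -> h + t * (b - eta) < f (x + t *: e) :> R ->
    h - d < f x :> R /\ `|(f e : R) - b| <= eta.
  move=> Af; rewrite linear_shift => fxe.
  have fh := xh _ Af.
  have be : b - eta < f e :> R by rewrite -(ltr_pM2l t0); lra.
  have fx : h - d < f x :> R.
    have := annihilator_ball_le e Af; rewrite ler_norml => /andP[_ fe].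
    have : t * (f e : R) <= t * `|e| by rewrite ler_pM2l.
    have : 0 <= t * b by rewrite mulr_ge0// ltW.
    by lra.
  split=> //; have := d1b f Af; rewrite ler_norml => /(_ _); lra.
exists (x + t *: e), (h + t * (b - eta)); split.
  have [||f [Af fx fe]] := tb2 (eta / 2) (t * eta / 2).
  - by rewrite divr_gt0.
  - by rewrite divr_gt0// mulr_gt0.
  exists f => //; rewrite linear_shift.
  have : t * (b - eta / 2) < t * (f e : R) by rewrite ltr_pM2l.
  by lra.
move=> f1 f2 Af1 Af2 /(tilt _ Af1)[f1x f1e] /(tilt _ Af2)[f2x f2e] z.
have [F1 [c1 [AF1 F1e F1x c1k F1E]]] :=
  annihilator_ball_kernel xh Af1 Ag Au ue mu0 mu1 mua f1x gx f1e ge' dh kN.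
have [F2 [c2 [AF2 F2e F2x c2k F2E]]] :=
  annihilator_ball_kernel xh Af2 Ag Au ue mu0 mu1 mua f2x gx f2e ge' dh kN.
(* The terms in [g] cancel; the middle term appears because the two total weights differ by
   [|c1| - |c2|]. *)
have -> : (f1 z : R) - (f2 z : R) =
    (1 + mu + `|c1|) * ((F1 z : R) - (F2 z : R)) + (`|c1| - `|c2|) * (F2 z : R)
    - (c1 - c2) * (u z : R).
  have := F1E z; have := F2E z; lra.
have F12 : `|(1 + mu + `|c1|) * ((F1 z : R) - (F2 z : R))| <= 3 * (eps * `|z|).
  rewrite normrM; apply: ler_pM => //; last exact: small.
  by rewrite ger0_norm ?addr_ge0//; lra.
have FZ : `|(`|c1| - `|c2|) * (F2 z : R)| <= kappa * `|z|.
  rewrite normrM; apply: ler_pM => //; last exact: annihilator_ball_le AF2.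
  by have := normr_ge0 c1; have := normr_ge0 c2; rewrite ler_norml; lra.
have uZ : `|(c1 - c2) * (u z : R)| <= 2 * kappa * `|z|.
  rewrite normrM; apply: ler_pM => //; last exact: annihilator_ball_le Au.
  by rewrite (le_trans (ler_normB _ _))//; lra.
have kz : kappa * `|z| <= eps / 2 * `|z| by rewrite ler_wpM2r.
have ez : 0 <= eps * `|z| by rewrite mulr_ge0// ltW.
by rewrite (le_trans (ler_normB _ _))// (le_trans (lerD (ler_normD _ _) (lexx _)))//; lra.
Qed.

(** * Removing one vector from the annihilated set *)

Lemma top_slope_small_slice A (e : Z) :
  (forall eps, 0 < eps -> small_slice (A `|` [set e]) eps) ->
  forall eps, 0 < eps -> small_slice A eps.
Proof.
move=> small eps eps0.
have e50 : 0 < eps / 5 by rewrite divr_gt0.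
have [x [m [[f0 /annihilator_ballU[Af0 f0e] f0x] close]]] := small _ e50.
have [[v [Av ve]]|noe] := pselect (exists v, annihilator_ball A v /\ v e <> 0);
    last first.
  have Ae f : annihilator_ball A f -> annihilator_ball (A `|` [set e]) f.
    move=> Af; apply/annihilator_ballU; split=> //.
    by apply: contrapT => fe; apply: noe; exists f.
  exists x, m; split; first by exists f0.
  move=> f g Af Ag fx gx z.
  apply: le_trans (close _ _ (Ae _ Af) (Ae _ Ag) fx gx z) _.
  by apply: ler_wpM2r => //; lra.
have [w Aw wE] := annihilator_ballN Av.
wlog {ve} ve : v w Av Aw wE / 0 < v e :> R.
  move=> wl; move/eqP : ve; rewrite neq_lt => /orP[ve|]; last exact: wl Aw wE.
  by apply: (wl w v) => // [z|]; rewrite wE ?opprK// oppr_gt0.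
pose S := [set (f x : R) | f in [set f | annihilator_ball A f /\ f e = 0]].
have ubS : has_ubound S.
  exists `|x| => _ [f [Af _] <-].
  by rewrite (le_trans (ler_norm _))// (annihilator_ball_le _ Af).
have supS : has_sup S by split=> //; exists (f0 x), f0.
pose h := sup S.
have Sh f : annihilator_ball A f -> f e = 0 -> (f x : R) <= h.
  by move=> Af fe; apply: ub_le_sup => //; exists f.
have mh : m < h by apply: lt_le_trans f0x (Sh _ _ _).
(* The convex combination of [f] and [g] that vanishes at [e] is at most [h] at [x]. As in the
   Hahn-Banach extension step, this leaves room for an [s] between the two families of quotients. *)
have slope f g : annihilator_ball A f -> annihilator_ball A g ->
    0 < f e :> R -> g e < 0 :> R ->
    (h - (g x : R)) / (g e : R) <= (h - (f x : R)) / (f e : R).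
  move=> Af Ag fe ge.
  have D0 : 0 < (f e : R) - (g e : R) by lra.
  have Dn : (f e : R) - (g e : R) != 0 by rewrite gt_eqF.
  have [|k Ak kE] := @annihilator_ball_comb A f g g
    (- (g e : R) / ((f e : R) - (g e : R))) ((f e : R) / ((f e : R) - (g e : R))) 0
    Af Ag Ag.
    rewrite normr0 addr0 !normrM !normfV (gtr0_norm D0) normrN (ltr0_norm ge).
    by rewrite (gtr0_norm fe) -mulrDl addrC divff.
  have ke : k e = 0 by rewrite kE; field.
  have := Sh _ Ak ke.
  rewrite kE mul0r addr0 -![_ / _ * _]mulrAC -mulrDl ler_pdivrMr// => kx.
  by rewrite ler_pdivlMr// mulrAC ler_ndivrMr//; lra.
pose T := [set (h - (f x : R)) / (f e : R) | f in
  [set f | annihilator_ball A f /\ 0 < f e :> R]].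
have lbT : lbound T ((h - (w x : R)) / (w e : R)).
  by move=> _ [f [Af fe] <-]; apply: slope => //; rewrite wE oppr_lt0.
pose s := inf T.
have Tv : T ((h - (v x : R)) / (v e : R)) by exists v.
have sh f : annihilator_ball A f -> (f (x + s *: e) : R) <= h.
  move=> Af; rewrite linear_shift.
  have [fe|fe|fe] := ltgtP (f e : R) 0; last by rewrite fe mulr0 addr0 Sh.
    have : (h - (f x : R)) / (f e : R) <= s.
      by apply: lb_le_inf; [eexists; exact: Tv|move=> _ [g [Ag ge] <-]; exact: slope].
    by rewrite ler_ndivrMr//; lra.
  have : s <= (h - (f x : R)) / (f e : R).
    by apply: ge_inf; [exists ((h - (w x : R)) / (w e : R))|exists f].
  by rewrite ler_pdivlMr//; lra.
have shift f : f e = 0 -> (f (x + s *: e) : R) = f x.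
  by move=> fe; rewrite linear_shift fe mulr0 addr0.
have adh d : 0 < d -> exists f,
    [/\ annihilator_ball A f, f e = 0 & h - d < f (x + s *: e) :> R].
  move=> d0; have [_ [f [Af fe] <-] fh] := sup_adherent d0 supS.
  by exists f; rewrite shift.
have [b b0 tb] := top_slope_exists adh.
have [|a a0 ta] := @top_slope_exists A (x + s *: e) (- e) h.
  by move=> d /adh[f [Af fe fx]]; exists f; rewrite linearN /= fe oppr0.
have close' f g : annihilator_ball A f -> annihilator_ball A g ->
    f e = 0 -> g e = 0 -> m < f (x + s *: e) :> R -> m < g (x + s *: e) :> R ->
    forall z, `|(f z : R) - (g z : R)| <= eps / 5 * `|z|.
  move=> Af Ag fe ge; rewrite !shift// => fx gx.
  by apply: close => //; apply/annihilator_ballU.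
have -> : eps = 5 * (eps / 5) by field.
(* Replacing [e] by [-e] exchanges [a] and [b], and [w], which is positive at [-e], takes the place
   of [v]. *)
have [ba|ab] := leP b a.
  by apply: (small_slice_top_slope e50 mh sh Av ve _ tb ta close'); rewrite b0.
apply: (@small_slice_top_slope A (x + s *: e) (- e) h m b a (eps / 5) w) => //.
- by rewrite linearN /= wE opprK.
- by rewrite a0 ltW.
- by rewrite opprK.
move=> f g Af Ag; rewrite !linearN /= => /eqP; rewrite oppr_eq0 => /eqP fe.
by move=> /eqP; rewrite oppr_eq0 => /eqP; exact: close'.
Qed.

(** * Small slices and roughness *)

Lemma small_slice_non_rough :
  (forall eps, 0 < eps -> small_slice set0 eps) -> non_rough Z.
Proof.
move=> small eps eps0 rZ.
have e20 : 0 < eps / 2 by rewrite divr_gt0.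
have [x [m [[f0 [f01 _] f0x] close]]] := small _ e20.
pose S := [set (g x : R) | g in dual_ball Z].
have ubS : has_ubound S.
  by exists `|x| => _ [f /dual_ballP f1 <-]; exact: le_trans (ler_norm _) (f1 x).
have mS : m < sup S by apply: lt_le_trans f0x _; apply: ub_le_sup => //; exists f0.
(* This width puts the level of the slice at [m]; its diameter is then at most [eps / 2], strictly
   below [eps]. *)
have := rZ x (sup S - m); rewrite subr_gt0 => /(_ mS).
rewrite leNgt => /negP; apply.
apply: (@le_lt_trans _ _ (eps / 2)%:E); last by rewrite lte_fin; lra.
rewrite /dual_diam; apply: ge_ereal_sup => _ [[f g] [[/= f1 fx] [g1 gx]] <-].
rewrite subKr in fx gx.
apply/(opnorm_leP (f \- g : {linear Z -> R^o}) (ltW e20)) => z.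
by apply: close.
Qed.

Lemma non_rough_close_slice (eps : R) : non_rough Z -> 0 < eps ->
  exists z alpha, 0 < alpha /\ forall f g, wstar_slice z alpha f ->
    wstar_slice z alpha g -> forall y, `|(f y : R) - (g y : R)| <= eps * `|y|.
Proof.
move=> nr eps0; apply: contrapT => nslice; apply: (nr _ eps0) => z alpha alpha0.
rewrite leNgt; apply/negP => diam; apply: nslice; exists z, alpha; split=> // f g sf sg.
apply/(opnorm_leP (f \- g : {linear Z -> R^o}) (ltW eps0)).
by apply: le_trans (ltW diam); apply: ereal_sup_ubound; exists (f, g).
Qed.

End dual_ball.

(** * The dual ball of the quotient as an annihilator *)

Section quotient.
Variables (R : realType) (X : normedModType R) (Y : submodClosed X).
Variable cY : closed [set` Y].
Local Notation Q := (quotient_space cY).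
Local Notation pi := (quotient_map Y).

Lemma dual_ball_pullback (g : {linear Q -> R^o}) : dual_ball Q g ->
  exists2 f, annihilator_ball [set` Y] f & forall x, (f x : R) = g (pi x : Q).
Proof.
move=> /dual_ballP g1.
pose f (x : X) : R^o := g (pi x : Q).
have lf : linear f by move=> a x y; rewrite /f !linearP.
pose Lf : GRing.isLinear R X R^o *:%R f := GRing.isLinear.Build _ _ _ _ f lf.
pose F : {linear X -> R^o} := HB.pack f Lf.
exists F => //; split=> [|y yY].
  by apply/dual_ballP => x; rewrite (le_trans (g1 _))// quotient_norm_le.
rewrite /F /= /f (_ : pi y = 0) ?linear0//.
by rewrite -(raddf0 pi); apply/quotient_map_eq; rewrite subr0.
Qed.

Lemma annihilator_ball_factor (f : {linear X -> R^o}) :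
  annihilator_ball [set` Y] f ->
  exists2 g, dual_ball Q g & forall x, (f x : R) = g (pi x : Q).
Proof.
move=> [/dual_ballP f1 fY].
have f_pi x y : pi x = pi y -> f x = f y.
  by move=> /quotient_map_eq/fY/eqP; rewrite linearB subr_eq0 => /eqP.
have /boolp.choice[r rK] : forall q : Q, exists x, pi x = q.
  exact: quotient_map_surj.
(* [r] need not be linear: [g] is, because [f] depends only on the class of its argument.
   Representatives of nearly minimal norm then bound [g]. *)
pose g (q : Q) : R^o := f (r q).
have lg : linear g.
  by move=> a p q; rewrite /g -linearP; apply: f_pi; rewrite linearP rK -{1}(rK p) -{1}(rK q).
pose Lg : GRing.isLinear R Q R^o *:%R g := GRing.isLinear.Build _ _ _ _ g lg.
pose G : {linear Q -> R^o} := HB.pack g Lg.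
exists G => [|x]; last by apply: f_pi; rewrite rK.
apply/dual_ballP => q; apply/ler_addgt0Pr => e e0.
have [x xq xe] := quotient_norm_adh q e0.
rewrite (_ : G q = f x); last by apply: f_pi; rewrite rK.
exact: le_trans (f1 x) (ltW xe).
Qed.

(** Corresponding functionals agree at [x] and at its class [z], so the slices match; the estimate
    lifts since the quotient map does not increase norms. *)
Lemma non_rough_quotient_small_slice (eps : R) :
  non_rough Q -> 0 < eps -> small_slice [set` Y] eps.
Proof.
move=> nr eps0; have [z [alpha [alpha0 close]]] := non_rough_close_slice nr eps0.
have [x xz] := quotient_map_surj z.
pose S := [set (g z : R) | g in dual_ball Q].
have supS : has_sup S.
  split; last first.
    by exists `|z| => _ [f /dual_ballP f1 <-]; exact: le_trans (ler_norm _) (f1 z).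
  by exists 0, (\0 : {linear Q -> R^o}) => //; apply/dual_ballP => y; rewrite normr0.
exists x, (sup S - alpha); split.
  have [_ [g g1 <-] gz] := sup_adherent alpha0 supS.
  by have [f Yf fE] := dual_ball_pullback g1; exists f; rewrite // fE xz.
move=> f g /annihilator_ball_factor[f' f'1 fE] /annihilator_ball_factor[g' g'1 gE].
rewrite !fE !gE xz => fz gz y; rewrite fE gE.
apply: le_trans (close f' g' _ _ _) _; [by []..|].
by rewrite ler_wpM2l ?(ltW eps0)// quotient_norm_le.
Qed.

End quotient.

(** * Induction along a finite spanning family *)

Lemma finite_dimensional_small_slice (R : realType) (X : normedModType R)
    (Y : submodClosed X) : finite_dimensional Y ->
  (forall eps, 0 < eps -> small_slice [set` Y] eps) ->
  forall eps, 0 < eps -> small_slice (set0 : set X) eps.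
Proof.
move=> [n [e Ye]] small.
(* The first [k] spanning vectors: [E n] has the same annihilator as [Y], and the vectors are
   dropped from the last one down to [E 0], which is empty. *)
pose E k := [set x | exists2 i : 'I_n, (i < k)%N & x = e i].
have En : annihilator_ball (E n) = annihilator_ball [set` Y].
  apply/seteqP; split=> f [f1 f0]; split=> //.
    move=> y /Ye[a ->]; rewrite linear_sum big1// => i _.
    by rewrite linearZ /= (f0 (e i)) ?scaler0//; exists i.
  move=> _ [i _ ->]; apply: f0; apply/Ye; exists (fun j => (j == i)%:R).
  rewrite (bigD1 i)//= eqxx scale1r big1 ?addr0// => j /negbTE ->.
  by rewrite scale0r.
have E0 : E 0 = set0 by apply/seteqP; split=> // x [].
suff step k : (k <= n)%N -> forall eps, 0 < eps -> small_slice (E (n - k)%N) eps.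
  by have := step n (leqnn n); rewrite subnn E0.
elim: k => [_|k IH kn]; first by rewrite subn0 /small_slice En; exact: small.
have nk : (n - k.+1 < n)%N by rewrite ltn_subrL (leq_trans _ kn).
apply: (@top_slope_small_slice _ _ _ (e (Ordinal nk))).
rewrite (_ : _ `|` _ = E (n - k)%N); first exact: IH (ltnW kn).
rewrite (_ : (n - k)%N = (n - k.+1).+1); last by rewrite -subSn// subSS.
apply/seteqP; split=> x /=.
  move=> [[i ik ->]|->]; first by exists i => //; exact: ltnW.
  by exists (Ordinal nk).
move=> [i]; rewrite ltnS leq_eqVlt => /orP[/eqP ik ->|ik ->].
  by right; congr e; apply: val_inj.
by left; exists i.
Qed.

Theorem theorem2p10 (R : realType) (X : completeNormedModType R)
    (Y : submodClosed X) (fdY : finite_dimensional Y)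
    (P : {linear X -> X}) :
  continuous P ->
  range P = [set` Y] ->
  {in Y, forall y, P y = y} ->
  opnorm P = 1%:E ->
  non_rough (quotient_space (finite_dimensional_closed fdY)) ->
  non_rough X.
Proof.
move=> _ _ _ _ nrQ; apply/small_slice_non_rough/(finite_dimensional_small_slice fdY).
by move=> eps eps0; exact: non_rough_quotient_small_slice nrQ eps0.
Qed.
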